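(* Let $p,q$ be odd integers with $0<p<q$ and $\gcd(p,q)=1$, let $K_{p/q}$ be the corresponding 2-bridge knot, let $\ell$ be an odd prime dividing $q$, and let $\lambda=e^{2\pi i/\ell}$. Put $\epsilon_i=(-1)^{\lfloor ip/q\rfloor}$ for $1\le i\le q-1$, $$d_{p/q}(\lambda,t)=\sum_{k=1}^{(q-1)/2}t^{\sum_{j=1}^{2k-1}\epsilon_j}\lambda^{k\epsilon_{2k}},\qquad e_{p/q}(\lambda,t)=1+\sum_{k=1}^{(q-1)/2}t^{\sum_{j=1}^{2k}\epsilon_j}\lambda^{k\epsilon_{2k}},$$ $$\Delta_{K_{p/q}}(t)=1-t^{\epsilon_1}+t^{\epsilon_1+\epsilon_2}-\dots+t^{\epsilon_1+\epsilon_2+\dots+\epsilon_{q-1}}.$$ Then the $\ell$-twisted Alexander polynomial $\tilde\Delta^\ell_{p/q}(t)$ of $K_{p/q}$ (computed from any surjection of the knot group onto the dihedral group $D_\ell$) satisfies $$\tilde\Delta^\ell_{p/q}(t)\doteq\frac{\Delta_{K_{p/q}}(t)}{t-1}\prod_{i=1}^{\frac{\ell-1}{2}}\frac{d_{p/q}(\lambda^i,t)\,d_{p/q}(\lambda^{-i},t)-e_{p/q}(\lambda^i,t)\,e_{p/q}(\lambda^{-i},t)}{t^2-1},$$ where $\doteq$ denotes equality up to a factor of the form $\pm t^{r\ell}$, $r\in\mathbb Z$.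
   Context: The knot group of $K_{p/q}$ is $G_{p/q}=\langle a,b\mid aw=wb\rangle$ with $w=b^{\epsilon_1}a^{\epsilon_2}b^{\epsilon_3}\cdots b^{\epsilon_{q-2}}a^{\epsilon_{q-1}}$. The dihedral group is $D_\ell=\langle x,y\mid x^2=1,\ y^\ell=1,\ yx=xy^{-1}\rangle$ (order $2\ell$). Fix the faithful representation $\pi:D_\ell\to GL(\ell,\mathbb C)$ with $\pi(x)=F$, the $\ell\times\ell$ matrix with ones on the antidiagonal and zeros elsewhere, and $\pi(y)=R$, the cyclic permutation matrix with ones in positions $(1,\ell)$ and $(i+1,i)$, $1\le i<\ell$, and zeros elsewhere. Let $\rho:G_{p/q}\to D_\ell$ be any surjective homomorphism (one exists since $\ell\mid q$) and $\phi=\pi\circ\rho$. Let $\partial w/\partial a$ be the Fox derivative in the integral group ring of the free group on $a,b$, and let $$\hat A_\phi=I+(t\phi(a)-I)\left.\frac{\partial w}{\partial a}\right|_{a=t\phi(a),\,b=t\phi(b)},$$ an $\ell\times\ell$ matrix over $\mathbb C[t,t^{-1}]$ (the element $1$ of the group ring is replaced by the identity matrix $I$). The $\ell$-twisted Alexander polynomial of $K_{p/q}$ is $$\tilde\Delta^\ell_{p/q}(t)=\frac{\det\hat A_\phi}{\det(t\phi(b)-I)},$$ which as a knot invariant is considered up to factors $\pm t^{r\ell}$, $r\in\mathbb Z$. *)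

(* Defs.v *)
From HB Require Import structures.
From mathcomp.multinomials Require Import freeg.
From mathcomp Require Import all_boot all_order all_algebra.
From mathcomp Require Import all_classical all_reals trigo.
From mathcomp Require Import generic_quotient complex zify.

Set Implicit Arguments.
Unset Strict Implicit.
Unset Printing Implicit Defensive.

Import Order.TTheory GRing.Theory Num.Theory.
Local Open Scope ring_scope.

(* The letter (s, false) stands for the generator s, and (s, true) for s^-1. *)
Section FreeGroup.
Variable T : choiceType.
Local Notation letter := (T * bool)%type.
Implicit Types (l m : letter) (u v w : seq letter).

Definition letter_inv l : letter := (l.1, ~~ l.2).

Definition freely_reduced w := sorted (fun l m => m != letter_inv l) w.

Record free_group := FreeGroup {
  word_of :> seq letter;
  word_ofP : freely_reduced word_of }.

HB.instance Definition _ := [isSub for word_of].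
HB.instance Definition _ := [Choice of free_group by <:].

Definition letter_cons l w :=
  if w is m :: w' then if m == letter_inv l then w' else l :: w else [:: l].

Definition word_mul u v := foldr letter_cons v u.
Definition word_inv u := rev (map letter_inv u).

Lemma letter_invK : involutive letter_inv.
Proof. by case=> s b; rewrite /letter_inv /= negbK. Qed.

Lemma letter_cons_reduced l w :
  freely_reduced w -> freely_reduced (letter_cons l w).
Proof.
case: w => //= m w; case: ifPn => [_ /path_sorted//|ml] /= mw.
by rewrite ml.
Qed.

Lemma word_mul_reduced u v :
  freely_reduced v -> freely_reduced (word_mul u v).
Proof. by move=> rv; elim: u => //= l u; exact: letter_cons_reduced. Qed.

Lemma letter_consK l w :
  freely_reduced w -> letter_cons l (letter_cons (letter_inv l) w) = w.
Proof.
case: w => [|m w] /=; first by rewrite eqxx.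
rewrite letter_invK; case: eqP => [->|_] /=; last by rewrite eqxx.
by case: w => //= k w /andP[/negbTE->].
Qed.

Lemma word_mul_cons l u v : freely_reduced u -> freely_reduced v ->
  word_mul (letter_cons l u) v = letter_cons l (word_mul u v).
Proof.
case: u => [|m u] //= ru rv; case: eqP => // ->.
by rewrite letter_consK // word_mul_reduced.
Qed.

Lemma word_mulA u v w : freely_reduced v -> freely_reduced w ->
  word_mul u (word_mul v w) = word_mul (word_mul u v) w.
Proof.
move=> rv rw; elim: u => //= l u ->.
by rewrite word_mul_cons // word_mul_reduced.
Qed.

Lemma word_mulw0 u : freely_reduced u -> word_mul u [::] = u.
Proof.
elim: u => //= l u IHu ru; rewrite IHu; last exact: path_sorted ru.
by case: u ru {IHu} => //= m u /andP[/negbTE->].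
Qed.

Lemma word_inv_reduced u : freely_reduced u -> freely_reduced (word_inv u).
Proof.
rewrite /freely_reduced /word_inv rev_sorted sorted_map.
apply: sub_sorted => l m /=; apply: contra => /eqP e.
by rewrite letter_invK in e; rewrite e.
Qed.

Lemma word_mulV u : word_mul (word_inv u) u = [::].
Proof.
rewrite /word_inv /word_mul; elim: u => //= l u IHu.
rewrite rev_cons foldr_rcons /= -[X in if X == _ then _ else _]letter_invK.
by rewrite eqxx IHu.
Qed.

Lemma word_invK : involutive word_inv.
Proof.
by move=> u; rewrite /word_inv map_rev revK -map_comp map_id_in // => l _;
   exact: letter_invK.
Qed.

Definition free_one := @FreeGroup [::] isT.
Definition free_mul (u v : free_group) :=
  FreeGroup (word_mul_reduced u (word_ofP v)).
Definition free_inv (u : free_group) := FreeGroup (word_inv_reduced (word_ofP u)).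

Lemma free_mulA : associative free_mul.
Proof. by move=> u v w; apply/val_inj/word_mulA; exact: word_ofP. Qed.
Lemma free_mul1g : left_id free_one free_mul.
Proof. by move=> u; exact: val_inj. Qed.
Lemma free_mulg1 : right_id free_one free_mul.
Proof. by move=> u; apply/val_inj/word_mulw0/word_ofP. Qed.
Lemma free_mulVg : left_inverse free_one free_inv free_mul.
Proof. by move=> u; apply/val_inj/word_mulV. Qed.
Lemma free_mulgV : right_inverse free_one free_inv free_mul.
Proof.
move=> u; apply/val_inj; rewrite /= -{1}[word_of u]word_invK.
exact: word_mulV.
Qed.

HB.instance Definition _ := isGroup.Build free_group
  free_mulA free_mul1g free_mulg1 free_mulVg free_mulgV.

Definition free_gen (s : T) : free_group := @FreeGroup [:: (s, false)] isT.

End FreeGroup.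

Section FreeMorphism.
Variables (T : choiceType) (G : groupType) (f : T -> G).
Local Open Scope group_scope.

Definition letter_val (l : T * bool) : G := if l.2 then (f l.1)^-1 else f l.1.

(* The homomorphism extending f : T -> G. *)
Definition free_mor (u : free_group T) : G := \prod_(l <- word_of u) letter_val l.

Lemma letter_valV l : letter_val (letter_inv l) = (letter_val l)^-1.
Proof. by case: l => s [] /=; rewrite /letter_val /= ?invgK. Qed.

Lemma free_mor_is_monoid_morphism :
  (free_mor 1 = 1) * {morph free_mor : u v / u * v}.
Proof.
split=> [|u v]; first by rewrite /free_mor big_nil.
rewrite /free_mor /=; elim: (word_of u) => [|l w IHw] /=.
  by rewrite big_nil mul1g.
rewrite big_cons -mulgA -IHw; case: (word_mul w v) => [|m w'] /=.
  by rewrite !big_cons.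
case: eqP => [->|_]; last by rewrite !big_cons.
by rewrite big_cons letter_valV mulVKg.
Qed.

HB.instance Definition _ := isUMagmaMorphism.Build (free_group T) G free_mor
  free_mor_is_monoid_morphism.

Lemma free_mor_gen s : free_mor (free_gen s) = f s.
Proof. by rewrite /free_mor big_seq1. Qed.

End FreeMorphism.

Section PresentedGroup.
Variables (T : choiceType) (rels : seq (free_group T)).
Local Open Scope group_scope.

Inductive normal_closure : free_group T -> Prop :=
| ncl_rel r of r \in rels : normal_closure r
| ncl_one : normal_closure 1
| ncl_mul u v of normal_closure u & normal_closure v : normal_closure (u * v)
| ncl_inv u of normal_closure u : normal_closure u^-1
| ncl_conj u v of normal_closure u : normal_closure (u ^ v).

Definition pres_rel (u v : free_group T) : bool :=
  `[< normal_closure (u^-1 * v) >].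

Lemma pres_rel_refl : reflexive pres_rel.
Proof. by move=> u; apply/asboolP; rewrite mulVg; exact: ncl_one. Qed.

Lemma pres_rel_sym : symmetric pres_rel.
Proof.
suff h u v : pres_rel u v -> pres_rel v u by move=> u v; apply/idP/idP; exact: h.
by move=> /asboolP/ncl_inv; rewrite invgM invgK => ?; apply/asboolP.
Qed.

Lemma pres_rel_trans : transitive pres_rel.
Proof.
move=> v u w /asboolP uv /asboolP vw; apply/asboolP.
by have := ncl_mul uv vw; rewrite -mulgA mulVKg.
Qed.

Canonical pres_equiv :=
  EquivRel pres_rel pres_rel_refl pres_rel_sym pres_rel_trans.

(* The group < T | r = 1, r in rels >, that is, the free group on T modulo the
   normal closure of rels. *)
Definition pres_group := {eq_quot pres_equiv}%qT.

HB.instance Definition _ := Choice.on pres_group.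
HB.instance Definition _ := Quotient.on pres_group.
HB.instance Definition _ : EqQuotient (free_group T) pres_equiv pres_group :=
  EqQuotient.on pres_group.

Local Notation cls := (\pi_pres_group)%qT.

Lemma pres_clsP u v : reflect (cls u = cls v) (pres_rel u v).
Proof. exact: eqmodP. Qed.

Lemma pres_surj x : exists u, x = cls u.
Proof. by exists (repr x); rewrite reprK. Qed.

Lemma pres_repr u : pres_rel (repr (cls u)) u.
Proof. by apply/pres_clsP; rewrite reprK. Qed.

Definition pres_one : pres_group := cls 1.
Definition pres_mul (x y : pres_group) : pres_group := cls (repr x * repr y).
Definition pres_inv (x : pres_group) : pres_group := cls (repr x)^-1.

Lemma pres_rel_mul u v u' v' :
  pres_rel u v -> pres_rel u' v' -> pres_rel (u * u') (v * v').
Proof.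
move=> /asboolP uv /asboolP uv'; apply/asboolP.
have := ncl_mul (ncl_conj u' uv) uv'.
by rewrite /conjg invgM !mulgA mulgK.
Qed.

Lemma pres_rel_inv u v : pres_rel u v -> pres_rel u^-1 v^-1.
Proof.
rewrite pres_rel_sym => /asboolP/(ncl_conj v^-1) h; apply/asboolP; move: h.
by rewrite /conjg !invgK !mulgA mulgV mul1g.
Qed.

Lemma pres_mulE u v : pres_mul (cls u) (cls v) = cls (u * v).
Proof. by apply/pres_clsP; apply: pres_rel_mul; exact: pres_repr. Qed.

Lemma pres_invE u : pres_inv (cls u) = cls u^-1.
Proof. by apply/pres_clsP; apply: pres_rel_inv; exact: pres_repr. Qed.

Lemma pres_mulA : associative pres_mul.
Proof.
move=> x y z; have [u ->] := pres_surj x; have [v ->] := pres_surj y.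
by have [w ->] := pres_surj z; rewrite !pres_mulE mulgA.
Qed.
Lemma pres_mul1g : left_id pres_one pres_mul.
Proof. by move=> x; have [u ->] := pres_surj x; rewrite pres_mulE mul1g. Qed.
Lemma pres_mulg1 : right_id pres_one pres_mul.
Proof. by move=> x; have [u ->] := pres_surj x; rewrite pres_mulE mulg1. Qed.
Lemma pres_mulVg : left_inverse pres_one pres_inv pres_mul.
Proof. by move=> x; have [u ->] := pres_surj x; rewrite pres_invE pres_mulE mulVg. Qed.
Lemma pres_mulgV : right_inverse pres_one pres_inv pres_mul.
Proof. by move=> x; have [u ->] := pres_surj x; rewrite pres_invE pres_mulE mulgV. Qed.

HB.instance Definition _ := isGroup.Build pres_group
  pres_mulA pres_mul1g pres_mulg1 pres_mulVg pres_mulgV.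

Definition pres_gen (s : T) : pres_group := cls (free_gen s).

Variables (G : groupType) (f : T -> G).
Hypothesis f_rels : {in rels, forall r, free_mor f r = 1}.

(* The homomorphism induced on the quotient by f : T -> G. *)
Definition pres_mor of {in rels, forall r, free_mor f r = 1} :=
  fun x : pres_group => free_mor f (repr x).

Lemma normal_closure_mor u : normal_closure u -> free_mor f u = 1.
Proof.
elim=> [r /f_rels//||v w _ v1 _ w1|v _ v1|v w _ v1]; first exact: gmulf1.
- by rewrite gmulfM /= v1 w1 mul1g.
- by rewrite gmulfV /= v1 invg1.
- by rewrite gmulfJ /= v1 conj1g.
Qed.

Lemma pres_morE u : pres_mor f_rels (cls u) = free_mor f u.
Proof.
have /asboolP/normal_closure_mor := pres_repr u.
by rewrite gmulfM gmulfV /= => /(canRL (mulVKg _)); rewrite mulg1.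
Qed.

Lemma pres_mor_is_monoid_morphism : (pres_mor f_rels 1 = 1) *
  {morph pres_mor f_rels : x y / x * y}.
Proof.
split=> [|x y]; first by rewrite [LHS]pres_morE gmulf1.
have [u ->] := pres_surj x; have [v ->] := pres_surj y.
by rewrite [X in pres_mor _ X]pres_mulE !pres_morE gmulfM.
Qed.

HB.instance Definition _ := @isUMagmaMorphism.Build pres_group G
  (pres_mor f_rels) pres_mor_is_monoid_morphism.

Lemma pres_mor_gen s : pres_mor f_rels (pres_gen s) = f s.
Proof. by rewrite pres_morE free_mor_gen. Qed.

End PresentedGroup.

Section GeneralLinearGroup.
Variables (n : nat) (K : fieldType).

Record GL := MkGL { GL_mx :> 'M[K]_n; GL_unitmx : GL_mx \in unitmx }.

HB.instance Definition _ := [isSub for GL_mx].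
HB.instance Definition _ := [Choice of GL by <:].

Definition GL_one := MkGL (unitmx1 K n).
Definition GL_mul (A B : GL) : GL :=
  @MkGL (A *m B) (eq_ind_r is_true (introT andP (conj (GL_unitmx A) (GL_unitmx B)))
    (unitmx_mul A B)).
Definition GL_inv (A : GL) : GL :=
  @MkGL (invmx A) (eq_ind_r is_true (GL_unitmx A) (unitmx_inv A)).

Lemma GL_mulA : associative GL_mul.
Proof. by move=> A B D; apply/val_inj/mulmxA. Qed.
Lemma GL_mul1g : left_id GL_one GL_mul.
Proof. by move=> A; apply/val_inj/mul1mx. Qed.
Lemma GL_mulg1 : right_id GL_one GL_mul.
Proof. by move=> A; apply/val_inj/mulmx1. Qed.
Lemma GL_mulVg : left_inverse GL_one GL_inv GL_mul.
Proof. by move=> A; apply/val_inj/mulVmx/GL_unitmx. Qed.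
Lemma GL_mulgV : right_inverse GL_one GL_inv GL_mul.
Proof. by move=> A; apply/val_inj/mulmxV/GL_unitmx. Qed.

HB.instance Definition _ := isGroup.Build GL
  GL_mulA GL_mul1g GL_mulg1 GL_mulVg GL_mulgV.

End GeneralLinearGroup.

(* Z[F(T)], as the free abelian group on the set F(T); of its product only left
   multiplication by a group element is needed. *)
Section FoxCalculus.
Variable T : choiceType.
Local Notation F := (free_group T).
Local Notation ZF := {freeg (free_group T) / int}.

Definition group_lmul (g : F) (x : ZF) : ZF :=
  fglift (fun h => << (g * h)%g >> : ZF) x.

Definition fox_letter (s : T) (l : T * bool) : ZF :=
  if l.1 == s then if l.2 then - << (free_gen s)^-1%g >> else << 1%g >> else 0.

Fixpoint fox_word (s : T) (w : seq (T * bool)) : ZF :=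
  if w is l :: w' then
    fox_letter s l + group_lmul (letter_val (@free_gen T) l) (fox_word s w')
  else 0.

(* The Fox derivative of u with respect to s, characterized by fox_free_gen and
   fox_mul. *)
Definition fox (s : T) (u : F) : ZF := fox_word s (word_of u).

Lemma group_lmulB g : {morph group_lmul g : x y / x - y}.
Proof. exact: lift_is_additive. Qed.
Lemma group_lmul0 g : group_lmul g 0 = 0.
Proof. by rewrite -[X in group_lmul g X](subrr 0) group_lmulB subrr. Qed.
Lemma group_lmulN g : {morph group_lmul g : x / - x}.
Proof. by move=> x; rewrite -sub0r group_lmulB group_lmul0 sub0r. Qed.
Lemma group_lmulD g : {morph group_lmul g : x y / x + y}.
Proof. by move=> x y; rewrite -{1}[y]opprK group_lmulB group_lmulN opprK. Qed.

Lemma group_lmulU g c h : group_lmul g << c *g h >> = << c *g (g * h)%g >>.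
Proof.
rewrite /group_lmul liftU; apply/eqP/freeg_eqP => k.
by rewrite coeffZ !coeffU mul1r.
Qed.

Lemma group_lmulM g h x : group_lmul (g * h)%g x = group_lmul g (group_lmul h x).
Proof.
rewrite -[x]freeg_sumE; elim/big_rec: _ => [|k y _ IH].
  by rewrite !group_lmul0.
by rewrite !group_lmulD IH !group_lmulU mulgA.
Qed.

Lemma group_lmul1 x : group_lmul 1%g x = x.
Proof.
rewrite -[x]freeg_sumE; elim/big_rec: _ => [|k y _ IH].
  by rewrite group_lmul0.
by rewrite group_lmulD IH group_lmulU mul1g.
Qed.

Lemma letter_val_gen l (w : F) :
  (letter_val (@free_gen T) l * w)%g = FreeGroup (letter_cons_reduced l (word_ofP w))
    :> F.
Proof. by apply/val_inj; case: l => s []. Qed.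

Lemma fox_letter_cancel s l (x : ZF) :
  fox_letter s l + group_lmul (letter_val (@free_gen T) l)
    (fox_letter s (letter_inv l) +
     group_lmul (letter_val (@free_gen T) (letter_inv l)) x) = x.
Proof.
rewrite group_lmulD -group_lmulM letter_valV mulgV group_lmul1 addrA.
rewrite (_ : _ + group_lmul _ _ = 0) ?add0r //.
case: l => r []; rewrite /fox_letter /letter_val /=; case: eqP => [->|_];
  rewrite ?group_lmul0 ?addr0 // ?group_lmulN ?group_lmulU ?mulg1 ?mulgV ?addNr //.
by rewrite subrr.
Qed.

Lemma fox_word_cons s l w :
  fox_word s (letter_cons l w) =
  fox_letter s l + group_lmul (letter_val (@free_gen T) l) (fox_word s w).
Proof.
case: w => //= m w; case: eqP => //= ->.
by rewrite fox_letter_cancel.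
Qed.

Lemma fox_free_gen s r : fox s (free_gen r) = if r == s then << 1%g >> else 0.
Proof. by rewrite /fox /= group_lmul0 addr0 /fox_letter. Qed.

Lemma free_mor_gen_id (u : F) : free_mor (@free_gen T) u = u.
Proof.
apply: val_inj; case: u => u; elim: u => [|l u IHu] ru /=.
  by rewrite /free_mor big_nil.
rewrite /free_mor big_cons letter_val_gen /=.
rewrite -[X in letter_cons l X]/(val (free_mor (@free_gen T)
  (FreeGroup (path_sorted ru)))) IHu /=.
by case: u ru {IHu} => //= m u /andP[/negbTE->].
Qed.

Lemma fox_mul s u v : fox s (u * v)%g = fox s u + group_lmul u (fox s v).
Proof.
rewrite -[in group_lmul u _](free_mor_gen_id u) /fox /free_mor /=.
elim: (word_of u) => [|l w IHw] /=; first by rewrite big_nil group_lmul1 add0r.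
by rewrite fox_word_cons IHw group_lmulD big_cons group_lmulM addrA.
Qed.

End FoxCalculus.

Section DihedralRepresentation.
Variables (n : nat) (K : fieldType).

Definition flip_mx : 'M[K]_n := \matrix_(i, j) (i + j == n.-1 :> nat)%N%:R.

Definition cycle_mx : 'M[K]_n :=
  \matrix_(i, j) (((i == 0 :> nat) && (j == n.-1 :> nat)) || (i == j.+1 :> nat))%:R.

Lemma flip_mxM m (A : 'M_(n, m)) i j : (flip_mx *m A) i j = A (rev_ord i) j.
Proof.
rewrite mxE (bigD1 (rev_ord i)) //= big1 ?addr0 => [|k ne_k].
  by rewrite mxE /= (_ : _ == _) ?mul1r //; apply/eqP; have := ltn_ord i; lia.
rewrite mxE (_ : _ == _ = false) ?mul0r //; apply: contra_neqF ne_k => /eqP e.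
by apply: val_inj => /=; have := ltn_ord i; have := ltn_ord k; lia.
Qed.

Lemma mul_flip_mx m (A : 'M_(m, n)) i j : (A *m flip_mx) i j = A i (rev_ord j).
Proof.
rewrite mxE (bigD1 (rev_ord j)) //= big1 ?addr0 => [|k ne_k].
  by rewrite mxE /= (_ : _ == _) ?mulr1 //; apply/eqP; have := ltn_ord j; lia.
rewrite mxE (_ : _ == _ = false) ?mulr0 //; apply: contra_neqF ne_k => /eqP e.
by apply: val_inj => /=; have := ltn_ord j; have := ltn_ord k; lia.
Qed.

Lemma cycle_mxE i j : cycle_mx i j = (j.+1 %% n == i)%N%:R.
Proof.
rewrite mxE; congr (nat_of_bool _)%:R; move: (ltn_ord i) (ltn_ord j).
move: (nat_of_ord i) (nat_of_ord j) => {i j} i j lti ltj.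
have [e|ne] := eqVneq j.+1 n; first by rewrite e modnn; lia.
by rewrite modn_small; lia.
Qed.

Lemma mul_cycle_mx m (A : 'M_(m, n)) i j : (A *m cycle_mx) i j = A i (ordS j).
Proof.
rewrite mxE (bigD1 (ordS j)) //= big1 ?addr0 => [|k ne_k].
  by rewrite cycle_mxE eqxx mulr1.
by rewrite cycle_mxE -[_ == _]/(ordS j == k) eq_sym (negbTE ne_k) mulr0.
Qed.

Lemma cycle_mx_trmx : cycle_mx^T *m cycle_mx = 1%:M.
Proof.
apply/matrixP => i j; rewrite mul_cycle_mx [LHS]mxE cycle_mxE [RHS]mxE.
by rewrite -[_ == _]/(ordS i == ordS j) (inj_eq (@ordS_inj n)).
Qed.

Lemma flip_mx_unit : flip_mx \in unitmx.
Proof.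
suff /mulmx1_unit[] : flip_mx *m flip_mx = 1%:M by [].
apply/matrixP => i j; rewrite flip_mxM !mxE; congr (nat_of_bool _)%:R.
by rewrite -val_eqE /=; have := ltn_ord i; have := ltn_ord j; lia.
Qed.

Lemma cycle_mx_unit : cycle_mx \in unitmx.
Proof. by have /mulmx1_unit[] := cycle_mx_trmx. Qed.

Definition GL_flip : GL n K := MkGL flip_mx_unit.
Definition GL_cycle : GL n K := MkGL cycle_mx_unit.

Lemma GL_flip_expg2 : (GL_flip ^+ 2 = 1)%g.
Proof.
apply: val_inj => /=.
apply/matrixP => i j; rewrite flip_mxM !mxE; congr (nat_of_bool _)%:R.
by rewrite -val_eqE /=; have := ltn_ord i; have := ltn_ord j; lia.
Qed.

Lemma GL_cycle_expgE k i j : val (GL_cycle ^+ k)%g i j = ((j + k) %% n == i)%N%:R.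
Proof.
elim: k i j => [|k IHk] i j.
  by rewrite addn0 modn_small // mxE eq_sym.
by rewrite expgSr mul_cycle_mx IHk /= modnDml addSnnS.
Qed.

Lemma GL_cycle_expg : (GL_cycle ^+ n = 1)%g.
Proof.
apply: val_inj; apply/matrixP => i j; rewrite GL_cycle_expgE modnDr modn_small //.
by rewrite mxE eq_sym.
Qed.

Lemma GL_cycle_flip : (GL_cycle * GL_flip = GL_flip * GL_cycle^-1)%g.
Proof.
apply: (mulIg GL_cycle); rewrite mulgVK; apply: val_inj; apply/matrixP => i j.
rewrite /= mul_cycle_mx mul_flip_mx cycle_mxE mxE; congr (nat_of_bool _)%:R.
move: (ltn_ord i) (ltn_ord j) => /=.
move: (nat_of_ord i) (nat_of_ord j) => {i j} i j lti ltj.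
have [e|ne] := eqVneq j.+1 n.
  by rewrite e modnn subn1 prednK ?modnn; lia.
by rewrite (modn_small (_ : j.+1 < n)%N) ?modn_small; lia.
Qed.

End DihedralRepresentation.

(* In both two-generator presentations below the alphabet is bool, with false
   for the first generator and true for the second. *)
Section Presentations.
Local Open Scope group_scope.

Definition zexpg (G : groupType) (x : G) (m : int) : G :=
  match m with Posz k => x ^+ k | Negz k => x ^- k.+1 end.

Definition eps (p q i : nat) : int := ((-1) ^+ (i * p %/ q))%R.

Definition two_bridge_word (p q : nat) : free_group bool :=
  \prod_(1 <= i < q)
    zexpg (if odd i then free_gen true else free_gen false) (eps p q i).

Definition knot_rels (p q : nat) : seq (free_group bool) :=
  let a := free_gen false in let b := free_gen true in
  let w := two_bridge_word p q in
  [:: (a * w) * (w * b)^-1].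

Definition knot_group (p q : nat) := pres_group (knot_rels p q).
HB.instance Definition _ p q := Group.on (knot_group p q).

Definition dihedral_rels (l : nat) : seq (free_group bool) :=
  let x := free_gen false in let y := free_gen true in
  [:: x ^+ 2; y ^+ l; (y * x) * (x * y^-1)^-1].

Definition dihedral_group (l : nat) := pres_group (dihedral_rels l).
HB.instance Definition _ l := Group.on (dihedral_group l).

Definition dihedral_gen_mx (l : nat) (K : fieldType) (s : bool) : GL l K :=
  if s then GL_cycle l K else GL_flip l K.

Lemma dihedral_rels_mx (l : nat) (K : fieldType) :
  {in dihedral_rels l, forall r, free_mor (@dihedral_gen_mx l K) r = 1}.
Proof.
move=> r; rewrite !inE => /or3P[] /eqP->.
- by rewrite gmulfXn /= free_mor_gen GL_flip_expg2.
- by rewrite gmulfXn /= free_mor_gen GL_cycle_expg.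
- rewrite gmulfF 2!gmulfM /= gmulfV /= !free_mor_gen /= GL_cycle_flip.
  by rewrite mulgV.
Qed.

Definition dihedral_repr (l : nat) (K : fieldType) : dihedral_group l -> GL l K :=
  pres_mor (@dihedral_rels_mx l K).
HB.instance Definition _ l K :=
  @isUMagmaMorphism.Build (dihedral_group l) (GL l K) (@dihedral_repr l K)
    (pres_mor_is_monoid_morphism (@dihedral_rels_mx l K)).

Lemma dihedral_repr_x (l : nat) (K : fieldType) :
  dihedral_repr K (pres_gen (dihedral_rels l) false) = GL_flip l K.
Proof. exact: pres_mor_gen. Qed.

Lemma dihedral_repr_y (l : nat) (K : fieldType) :
  dihedral_repr K (pres_gen (dihedral_rels l) true) = GL_cycle l K.
Proof. exact: pres_mor_gen. Qed.

End Presentations.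

Section TwistedAlexander.
Variable R : realType.
Local Notation C := R[i].
(* The ring C[t, t^-1] is regarded as a subring of the field C(t). *)
Local Notation Ct := {fraction {poly R[i]}}.

Definition ct_const (c : C) : Ct := tofrac c%:P.
Definition ct_var : Ct := tofrac 'X.
Local Notation t := ct_var.

Lemma scale_GL_unitmx n (A : GL n C) : t *: map_mx ct_const A \in unitmx.
Proof.
have cA : map_mx ct_const A \in unitmx.
  by rewrite (map_unitmx (@tofrac {poly C} \o @polyC C)) GL_unitmx.
have t_neq0 : t != 0 by rewrite /ct_var tofrac_eq0 polyX_eq0.
rewrite unitmxE detZ unitfE; apply: mulf_neq0; first exact: expf_neq0.
by move: cA; rewrite unitmxE unitfE.
Qed.

Definition scale_GL n (A : GL n C) : GL n Ct := MkGL (scale_GL_unitmx A).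

Section Twisted.
Variables (p q n : nat) (phi : knot_group p q -> GL n C).

Definition tphi (s : bool) : GL n Ct :=
  scale_GL (phi (pres_gen (knot_rels p q) s)).

(* Substitution of a = t phi(a), b = t phi(b): the Z-linear extension to Z[F(a, b)]
   of the group homomorphism free_mor tphi; zmodule M is M as a Z-module. *)
Definition eval_tphi (x : {freeg (free_group bool) / int}) : 'M[Ct]_n :=
  fglift (fun g => (free_mor tphi g : 'M[Ct]_n) : zmodule 'M[Ct]_n) x.

Definition fox_matrix : 'M[Ct]_n :=
  1%:M + ((tphi false : 'M_n) - 1%:M) *m eval_tphi (fox false (two_bridge_word p q)).

Definition twisted_alexander : Ct :=
  \det fox_matrix / \det ((tphi true : 'M_n) - 1%:M).

End Twisted.

Definition eps_sum (p q k : nat) : int := \sum_(1 <= j < k.+1) eps p q j.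

Definition alexander (p q : nat) : Ct :=
  \sum_(0 <= k < q) (-1) ^+ k * t ^ eps_sum p q k.

Definition d_poly (p q : nat) (z : C) : Ct :=
  \sum_(1 <= k < (q.-1)./2.+1)
    t ^ eps_sum p q (2 * k - 1) * ct_const (z ^ (k%:Z * eps p q (2 * k))).

Definition e_poly (p q : nat) (z : C) : Ct :=
  1 + \sum_(1 <= k < (q.-1)./2.+1)
    t ^ eps_sum p q (2 * k) * ct_const (z ^ (k%:Z * eps p q (2 * k))).

(* exp (2 i pi / l) *)
Definition lambda (l : nat) : C :=
  (cos (2 * trigo.pi / l%:R) +i* sin (2 * trigo.pi / l%:R))%C.

Definition eq_upto_unit (l : nat) (f g : Ct) : Prop :=
  exists (s : bool) (r : int), f = (-1) ^+ s * t ^ (r * l%:Z) * g.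

End TwistedAlexander.

Arguments ct_var {R}.
Arguments lambda {R} l.
Arguments alexander {R} p q.

(* Main.v *)
(** A representation rho sends both meridians to reflections x y^i, x y^j with
    i <> j mod l.  For a an l-th root of unity the row vector (a^0, ..., a^(l-1))
    is sent by each reflection to a multiple of the row vector of a^-1, so over
    C(t) the space splits into one fixed line (a = 1) and (l-1)/2 planes on which
    phi(ab) has eigenvalues lam^k, lam^-k.  On such a plane the free differential
    calculus gives  u A^ = e(lam^k) u - c d(lam^-k) u',  with 2x2 determinant
    e e~ - d d~, whereas t phi(b) - 1 has determinant 1 - t^2; on the fixed line one
    finds e(1) - d(1), which is the Alexander polynomial, and t - 1.  The formula
    holds on the nose, with unit factor 1. *)

Require Import Defs.
From mathcomp.multinomials Require Import freeg.
From mathcomp Require Import all_boot all_order all_algebra perm.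
From mathcomp Require Import all_classical all_reals complex.
From mathcomp Require Import trigo ring zify.

Set Implicit Arguments.
Unset Strict Implicit.
Unset Printing Implicit Defensive.

Import Order.TTheory GRing.Theory Num.Theory.
Local Open Scope ring_scope.

(** * Determinants of matrices preserving a line and a family of planes *)

Lemma det_block_diag_mx (K : idomainType) (n : nat) (f g g' h : 'rV[K]_n) :
  \det (block_mx (diag_mx f) (diag_mx g) (diag_mx g') (diag_mx h)) =
  \prod_k (f 0 k * h 0 k - g 0 k * g' 0 k).
Proof.
(* Replacing h by h + X makes the lower right block regular; then set X = 0. *)
pose up (v : 'rV[K]_n) := map_mx polyC v.
pose H := \row_k ((h 0 k)%:P + 'X) : 'rV[{poly K}]_n.
pose N := block_mx (diag_mx (up f)) (diag_mx (up g)) (diag_mx (up g')) (diag_mx H).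
have detN : \det N = \prod_k ((f 0 k)%:P * H 0 k - (g 0 k)%:P * (g' 0 k)%:P).
  have H_neq0 : \prod_k H 0 k != 0.
    apply/prodf_neq0 => k _; rewrite mxE addrC -size_poly_eq0.
    by rewrite size_XaddC.
  apply: (mulIf H_neq0).
  pose L := block_mx (diag_mx H) 0 (- diag_mx (up g')) 1%:M.
  have -> : \prod_k H 0 k = \det L by rewrite det_lblock det1 mulr1 det_diag.
  rewrite -det_mulmx mulmx_block !mulmxN !mulmx1 !mulmx0 !add0r !mulmx_diag.
  have -> : diag_mx (\row_j (up g' 0 j * H 0 j)) -
            diag_mx (\row_j (H 0 j * up g' 0 j)) = 0.
    by rewrite -raddfB /=; apply/matrixP => i j; rewrite !mxE mulrC subrr mul0rn.
  rewrite det_ublock -raddfB /= !det_diag; congr (_ * _).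
    by apply: eq_bigr => k _; rewrite !mxE.
  by rewrite det_lblock det1 mulr1 det_diag.
have -> : block_mx (diag_mx f) (diag_mx g) (diag_mx g') (diag_mx h) =
          map_mx (horner_eval 0) N.
  rewrite map_block_mx !map_diag_mx.
  by congr block_mx; congr diag_mx; apply/matrixP=> i j;
     rewrite ord1 !mxE /= /horner_eval !hornerE.
rewrite det_map_mx detN rmorph_prod; apply: eq_bigr => k _ /=.
by rewrite mxE /horner_eval !hornerE.
Qed.

(** In the basis formed by [u0] and the rows of [V] and [W], [M] becomes the block matrix [N], in
    which the k-th rows of [V] and [W] interact only with each other. *)
Lemma det_paired_rows (K : fieldType) (n : nat) (M : 'M[K]_(1 + (n + n)))
    (u0 : 'rV_(1 + (n + n))) (V W : 'M_(n, 1 + (n + n)))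
    (c0 : K) (f g g' h : 'rV_n) :
    col_mx u0 (col_mx V W) \in unitmx -> u0 *m M = c0 *: u0 ->
    (forall k, row k V *m M = f 0 k *: row k V + g 0 k *: row k W) ->
    (forall k, row k W *m M = h 0 k *: row k W + g' 0 k *: row k V) ->
  \det M = c0 * \prod_k (f 0 k * h 0 k - g 0 k * g' 0 k).
Proof.
move=> unitP u0M VM WM; set P := col_mx _ _ in unitP.
pose N : 'M[K]_(1 + (n + n)) := block_mx c0%:M 0 0
  (block_mx (diag_mx f) (diag_mx g) (diag_mx g') (diag_mx h)).
have PM : P *m M = N *m P.
  rewrite /P /N !mul_block_col !mul0mx addr0 add0r !mul_col_mx u0M.
  rewrite mul_scalar_mx !mul_diag_mx; congr col_mx; congr col_mx.
    by apply/row_matrixP => k; rewrite row_mul VM; apply/rowP=> j; rewrite !mxE.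
  by apply/row_matrixP => k; rewrite row_mul WM addrC; apply/rowP=> j; rewrite !mxE.
have detP : \det P != 0 by move: unitP; rewrite unitmxE unitfE.
apply: (mulfI detP); rewrite -det_mulmx PM det_mulmx mulrC; congr (_ * _).
by rewrite det_ublock det_scalar1 det_block_diag_mx.
Qed.

Lemma Vandermonde_unitmx (K : fieldType) (n : nat) (a : 'rV[K]_n) :
  injective (a 0) -> Vandermonde n a \in unitmx.
Proof.
move=> inj_a; rewrite unitmxE unitfE det_Vandermonde.
apply/prodf_neq0 => i _; apply/prodf_neq0 => j lt_ij.
by rewrite subr_eq0 (inj_eq inj_a) neq_ltn lt_ij orbT.
Qed.

(** * Presented groups and generating pairs of the dihedral group *)

Section Dihedral.
Local Open Scope group_scope.

Lemma free_group_ind (T : choiceType) (P : free_group T -> Prop) :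
    P 1 -> (forall s u, P u -> P (free_gen s * u)) ->
    (forall s u, P u -> P ((free_gen s)^-1 * u)) ->
  forall u, P u.
Proof.
move=> P1 Pgen Pinv u; rewrite -[u]free_mor_gen_id /free_mor.
elim/big_rec: _ => // -[s b] v _ Pv.
by case: b; [exact: Pinv | exact: Pgen].
Qed.

Lemma pres_group_ind (T : choiceType) (rels : seq (free_group T))
    (P : pres_group rels -> Prop) :
    P 1 -> (forall s x, P x -> P (pres_gen rels s * x)) ->
    (forall s x, P x -> P ((pres_gen rels s)^-1 * x)) ->
  forall x, P x.
Proof.
move=> P1 Pgen Pinv x; have [u ->] := pres_surj x.
elim/free_group_ind: u => // s u Pu; first by rewrite -pres_mulE; exact: Pgen.
by rewrite -pres_mulE -pres_invE; exact: Pinv.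
Qed.

(** Extending [pres_gen] to the free group gives the quotient map, and this kills relators. *)
Lemma pres_relator (T : choiceType) (rels : seq (free_group T)) r :
  r \in rels -> free_mor (@pres_gen T rels) r = 1.
Proof.
move=> rr; have <- : (\pi_(pres_group rels) r)%qT = free_mor (@pres_gen T rels) r.
  elim/free_group_ind: (r) => [|s u IH|s u IH].
  - by rewrite gmulf1.
  - by rewrite gmulfM /= free_mor_gen -IH -pres_mulE.
  - by rewrite gmulfM gmulfV /= free_mor_gen -IH -pres_mulE -pres_invE.
by apply/pres_clsP; apply/asboolP; rewrite mulg1; apply/ncl_inv/ncl_rel.
Qed.

Variable l : nat.
Hypothesis l_gt1 : (1 < l)%N.
Local Notation D := (dihedral_group l).
Local Notation x := (pres_gen (dihedral_rels l) false : D).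
Local Notation y := (pres_gen (dihedral_rels l) true : D).

Lemma dihedral_x2 : x * x = 1.
Proof.
have /pres_relator : (free_gen false ^+ 2) \in dihedral_rels l.
  by rewrite !inE eqxx.
by rewrite gmulfXn /= free_mor_gen.
Qed.

Lemma dihedral_yl : y ^+ l = 1.
Proof.
have /pres_relator : (free_gen true ^+ l) \in dihedral_rels l.
  by rewrite !inE eqxx orbT.
by rewrite gmulfXn /= free_mor_gen.
Qed.

Lemma dihedral_yx : y * x = x * y^-1.
Proof.
have /pres_relator : (free_gen true * free_gen false) *
    (free_gen false * (free_gen true)^-1)^-1 \in dihedral_rels l.
  by rewrite !inE eqxx !orbT.
by rewrite gmulfF 2!gmulfM /= gmulfV /= !free_mor_gen => /divg1_eq.
Qed.

(** The elements x^s y^k include 1 and are stable under left multiplication by the generators and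
    their inverses; y^-1 is rewritten as y^(l-1) to keep exponents natural. *)
Lemma dihedral_normal_form (g : D) : exists (s : bool) (k : nat), g = x ^+ s * y ^+ k.
Proof.
have yV : y^-1 = y ^+ l.-1.
  by apply: (mulgI y); rewrite mulgV -expgS prednK ?dihedral_yl //; lia.
have xV : x^-1 = x by apply: (mulgI x); rewrite mulgV dihedral_x2.
have yxE : y * x = x * y ^+ l.-1 by rewrite -yV dihedral_yx.
have yVx : y^-1 * x = x * y.
  by apply: (mulgI y); rewrite mulVKg mulgA dihedral_yx mulgVK.
have xM h : (exists (s : bool) k, h = x ^+ s * y ^+ k) ->
    exists (s : bool) k, x * h = x ^+ s * y ^+ k.
  move=> [s [k ->]]; exists (~~ s), k; rewrite mulgA; congr (_ * _).
  by case: s => /=; rewrite ?mulg1 ?dihedral_x2.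
elim/pres_group_ind: g => [|[] h [s [k ->]]|[] h [s [k ->]]].
- by exists false, 0; rewrite mulg1.
- exists s; case: s; last by exists k.+1; rewrite !mul1g expgS.
  by exists (l.-1 + k)%N; rewrite mulgA yxE -mulgA -expgnDr.
- by apply: xM; exists s, k.
- exists s; case: s; first by exists k.+1; rewrite mulgA yVx -mulgA -expgS.
  by exists (l.-1 + k)%N; rewrite !mul1g yV -expgnDr.
- by rewrite xV; apply: xM; exists s, k.
Qed.

(** The character of D that separates reflections from rotations; [{perm bool}] serves as the group
    of order two. *)
Definition dihedral_sign_gen (s : bool) : {perm bool} :=
  if s then 1 else tperm true false.

Lemma dihedral_sign_rels :
  {in dihedral_rels l, forall r, free_mor dihedral_sign_gen r = 1}.
Proof.
move=> r; rewrite !inE => /or3P[] /eqP->.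
- by rewrite gmulfXn /= free_mor_gen /= expgS expg1 tperm2.
- by rewrite gmulfXn /= free_mor_gen /= expg1n.
- rewrite gmulfF 2!gmulfM /= gmulfV /= !free_mor_gen /=.
  by rewrite invg1 mul1g mulg1 mulgV.
Qed.

Lemma dihedral_signE (s : bool) k :
  pres_mor dihedral_sign_rels (x ^+ s * y ^+ k) = tperm true false ^+ s.
Proof.
by rewrite gmulfM !gmulfXn /= !pres_mor_gen /= expg1n mulg1.
Qed.

(* The second hypothesis says that a and b generate D. *)
Lemma dihedral_generating_pair (a b w : D) :
    a * w = w * b ->
    (forall P : D -> Prop, P 1 -> (forall g, P g -> [/\ P (a * g), P (b * g),
       P (a^-1 * g) & P (b^-1 * g)]) -> forall g, P g) ->
  exists i j : nat, [/\ a = x * y ^+ i, b = x * y ^+ j & i != j %[mod l]].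
Proof.
move=> aw gen.
have tp1 : tperm true false != 1.
  by apply/eqP => /permP/(_ true); rewrite tpermL perm1.
(* The relation makes a and b conjugate, and signs are powers of a single transposition, so they
   commute and conjugation does not change them. *)
have sgn_ab : pres_mor dihedral_sign_rels a = pres_mor dihedral_sign_rels b.
  have := congr1 (pres_mor dihedral_sign_rels) aw; rewrite !gmulfM.
  have [s [k ->]] := dihedral_normal_form w; have [s' [k' ->]] := dihedral_normal_form a.
  have [s2 [k2 ->]] := dihedral_normal_form b; rewrite /= !dihedral_signE.
  by rewrite (commuteX2 _ _ (commute_refl _)) => /mulgI.
have sgn_yl k : pres_mor dihedral_sign_rels (y ^+ k) = 1.
  by have := dihedral_signE false k; rewrite mul1g.
have [s [i aE]] := dihedral_normal_form a; have [s' [j bE]] := dihedral_normal_form b.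
have es : s = s'.
  move: sgn_ab; rewrite aE bE !dihedral_signE => /eqP.
  by case: s {aE}; case: s' {bE} => //=; rewrite ?[1 == _]eq_sym (negbTE tp1).
(* Two rotations would generate only elements of trivial sign, which excludes x; hence a and b are
   both reflections. *)
move: es bE sgn_ab aE => <-; case: s => bE _ aE; last first.
  have : pres_mor dihedral_sign_rels x = 1.
    apply: (gen (fun g => pres_mor dihedral_sign_rels g = 1)); first exact: gmulf1.
    move=> g g1; rewrite !gmulfM !gmulfV /= g1 aE bE.
    by rewrite !dihedral_signE /= !invg1 !mul1g.
  by rewrite pres_mor_gen /= => /eqP; rewrite (negbTE tp1).
exists i, j; split=> //; apply/eqP => ij.
have yxi k : y ^+ k * x = x * y ^- k.
  elim: k => [|k IHk]; first by rewrite invg1 mulg1 mul1g.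
  by rewrite [in LHS]expgSr -mulgA dihedral_yx mulgA IHk -mulgA -invgM -expgS.
have aa : a * a = 1.
  by rewrite aE /= mulgA -[x * _ * x]mulgA yxi mulgA dihedral_x2 mul1g mulVg.
have ab : b = a.
  have ymod k : y ^+ k = y ^+ (k %% l).
    by rewrite {1}(divn_eq k l) expgnDr mulnC expgnA dihedral_yl expg1n mul1g.
  by rewrite aE bE (ymod j) (ymod i) ij.
have aV : a^-1 = a by apply: (mulgI a); rewrite mulgV aa.
(* With equal exponents b = a is an involution, so D would consist of 1 and a. But y is not 1, since
   the (0, 0) entry of the cyclic matrix vanishes for l > 1, and y is not a, since their signs
   differ. *)
have : y = 1 \/ y = a.
  apply: (gen (fun g => g = 1 \/ g = a)); first by left.
  move=> g; rewrite ab aV => ga.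
  have : a * g = 1 \/ a * g = a.
    by case: ga => ->; [right; rewrite mulg1 | left].
  by [].
case=> [y1|ya].
  have := dihedral_repr_y l rat; rewrite y1 gmulf1 => /(congr1 (@GL_mx _ _)).
  move=> /matrixP/(_ (Ordinal (ltnW l_gt1)) (Ordinal (ltnW l_gt1))).
  by rewrite cycle_mxE mxE /= modn_small.
have := sgn_yl 1%N; rewrite expg1 ya aE dihedral_signE /= => /eqP.
by rewrite (negbTE tp1).
Qed.

End Dihedral.

(** * Roots of unity *)

Section Lambda.
Variables (R : realType) (l : nat).
Hypothesis l_gt2 : (2 < l)%N.

Lemma lambda_exp k :
  lambda l ^+ k = (cos (2 * pi / l%:R *+ k) +i* sin (2 * pi / l%:R *+ k))%C :> R[i].
Proof.
rewrite /lambda; move: (2 * pi / l%:R) => x.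
elim: k => [|k IHk]; first by rewrite mulr0n cos0 sin0.
rewrite exprS IHk mulrS cosD sinD; apply/eqP; rewrite eq_complex /=.
by rewrite !eqxx /= addrC [cos _ * sin _]mulrC eqxx.
Qed.

Lemma lambda_expl : lambda l ^+ l = 1 :> R[i].
Proof.
rewrite lambda_exp -mulr_natr mulfVK ?pnatr_eq0; last by lia.
by rewrite mulrC mulr_natr cos2pi sin2pi.
Qed.

(** Its imaginary part is positive: l > 2 puts the angle strictly between 0 and pi. *)
Lemma lambda_neq1 : lambda l != 1 :> R[i].
Proof.
have l_gt0 : 0 < l%:R :> R by rewrite ltr0n; lia.
have : 0 < sin (2 * pi / l%:R) :> R.
  apply: sin_gt0_pi; rewrite divr_gt0 ?mulr_gt0 ?pi_gt0 //=.
  by rewrite ltr_pdivrMr // mulrC ltr_pM2l ?pi_gt0 // ltr_nat.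
by move=> h; rewrite /lambda eq_complex /= (gt_eqF h) andbF.
Qed.

End Lambda.

Lemma prim_root_prime (K : fieldType) (l : nat) (z : K) :
  prime l -> z ^+ l = 1 -> z != 1 -> l.-primitive_root z.
Proof.
move=> l_prime zl z_neq1.
have [m zm m_dvd] := prim_order_exists (prime_gt0 l_prime) zl.
have [_ /(_ m m_dvd) /pred2P[m1|<-//]] := primeP l_prime.
by move: zm z_neq1; rewrite m1 => /prim_expr_order; rewrite expr1 => ->; rewrite eqxx.
Qed.

(** This removes the dependence on the surjection: for meridians x y^i and x y^j, eigenvectors built
    from powers of [z] instead of [lam] make the eigenvalues of the product of the meridians powers
    of [lam] itself. *)
Lemma exists_root_slope (K : fieldType) (l : nat) (lam : K) (i j : nat) :
    prime l -> l.-primitive_root lam -> i != j %[mod l] ->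
  exists2 z : K, l.-primitive_root z & z ^+ j = lam * z ^+ i.
Proof.
move=> l_prime lamP ij; have lam0 : lam != 0.
  by rewrite (prim_root_eq0 lamP) -lt0n prime_gt0.
(* lam^(j - i) is primitive, hence lam = (lam^(j - i))^k and z = lam^k will do. *)
pose w := lam ^+ j / lam ^+ i.
have wl : w ^+ l = 1.
  rewrite expr_div_n -!exprM ![(_ * l)%N]mulnC !exprM (prim_expr_order lamP).
  by rewrite !expr1n divr1.
have w_prim : l.-primitive_root w.
  apply: prim_root_prime => //; apply: contra_neqN ij => /eqP w1.
  apply/eqP; rewrite -(eq_prim_root_expr lamP) eq_sym -subr_eq0.
  rewrite -(mulIr_eq0 _ (mulIf (invr_neq0 (expf_neq0 i lam0)))) mulrBl -/w.
  by rewrite divff ?expf_neq0 // w1 subrr.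
have /(prim_rootP w_prim) [k lamE] := prim_expr_order lamP.
exists (lam ^+ k).
  apply: prim_root_prime => //.
    by rewrite -exprM mulnC exprM (prim_expr_order lamP) expr1n.
  apply/eqP => lk; have : lam = 1.
    by rewrite lamE expr_div_n -!exprM ![(_ * k)%N]mulnC !exprM lk !expr1n divr1.
  move=> lam1; have := eq_prim_root_expr lamP 0 1; rewrite lam1 !expr1n eqxx.
  by rewrite mod0n modn_small ?prime_gt1.
rewrite [X in X * _]lamE expr_div_n -!exprM ![(k * _)%N]mulnC mulfVK //.
by rewrite expf_neq0.
Qed.

(** * The Fox matrix on a pair of lines exchanged by the meridians *)

Lemma eps_sign p q i : eps p q i = 1 \/ eps p q i = -1.
Proof. by rewrite /eps -signr_odd; case: odd; [right | left]. Qed.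

Lemma eps_sumS p q k : eps_sum p q k.+1 = eps_sum p q k + eps p q k.+1.
Proof. by rewrite /eps_sum big_nat_recr. Qed.

Lemma gmulf_zexpg (G H : groupType) (f : UMagmaMorphism.type G H) x m :
  f (zexpg x m) = zexpg (f x) m.
Proof. by case: m => k /=; rewrite ?gmulfXVn ?gmulfXn. Qed.

Section EvalFox.
Variables (K : fieldType) (p q n : nat) (t : K) (T : bool -> GL n K).
Hypothesis t_neq0 : t != 0.

(** [eval_tphi] for an arbitrary family [T], so that only the action of [T] on rows enters. *)
Definition mx_eval (x : {freeg (free_group bool) / int}) : 'M[K]_n :=
  fglift (fun g => (free_mor T g : 'M[K]_n) : zmodule 'M[K]_n) x.
Local Notation eval := mx_eval.

Lemma mx_evalB : {morph eval : x y / x - y}.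
Proof. exact: (@lift_is_additive _ _ (zmodule 'M[K]_n)). Qed.
Lemma mx_eval0 : eval 0 = 0.
Proof. by rewrite -[X in eval X](subrr 0) mx_evalB subrr. Qed.
Lemma mx_evalN : {morph eval : x / - x}.
Proof. by move=> x; rewrite -sub0r mx_evalB mx_eval0 sub0r. Qed.
Lemma mx_evalD : {morph eval : x y / x + y}.
Proof. by move=> x y; rewrite -{1}[y]opprK mx_evalB mx_evalN opprK. Qed.

Lemma mx_evalU c g : eval << c *g g >> = (free_mor T g : 'M_n) *~ c.
Proof. by rewrite /mx_eval liftU. Qed.

Lemma mx_eval_lmul g x :
  eval (group_lmul g x) = (free_mor T g : 'M_n) *m eval x.
Proof.
rewrite -[x]freeg_sumE; elim/big_rec: _ => [|k y _ IH].
  by rewrite group_lmul0 mx_eval0 mulmx0.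
rewrite group_lmulD !mx_evalD mulmxDr IH group_lmulU !mx_evalU gmulfM.
by rewrite (raddfMz (mulmx (free_mor T g : 'M_n))).
Qed.

(* The meridians a (s = false) and b (s = true) exchange the lines of u and u',
   and ab multiplies u by t^2 lam. *)
Definition swapped_by_meridians (c lam : K) (u u' : 'rV[K]_n) :=
  [/\ c != 0, lam != 0
    & forall s : bool, u *m (T s : 'M_n) = (t * (lam ^- s * c)) *: u'
                    /\ u' *m (T s : 'M_n) = (t * (lam ^+ s / c)) *: u].

Lemma swapped_by_meridiansC c lam u u' :
  swapped_by_meridians c lam u u' -> swapped_by_meridians c^-1 lam^-1 u' u.
Proof.
case=> c0 lam0 h; split; rewrite ?invr_eq0 // => s.
by have [h1 h2] := h s; rewrite exprVn !invrK; split.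
Qed.

(** Inverting a meridian inverts only the power of t: apart from t, its factors from [u] to [u'] and
    back are reciprocal, as for an involution. *)
Lemma swapped_by_letter c lam u u' s (m : int) :
  swapped_by_meridians c lam u u' -> m = 1 \/ m = -1 ->
  u *m (zexpg (T s) m : GL n K) = (t ^ m * (lam ^- s * c)) *: u'.
Proof.
case=> c0 lam0 /(_ s) [us u's] [->|->] /=; first by rewrite us.
have k0 : t * (lam ^+ s / c) != 0 by rewrite !mulf_neq0 ?expf_neq0 ?invr_neq0.
have -> : u = (t * (lam ^+ s / c))^-1 *: (u' *m (T s : 'M_n)).
  by rewrite u's scalerA mulVf // scale1r.
rewrite -[invmx _]/(invmx (T s : 'M_n)) -scalemxAl (mulmxK (Defs.GL_unitmx (T s))).
by rewrite exprN1 !invfM invrK.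
Qed.

Definition two_bridge_prefix (m : nat) : free_group bool :=
  (\prod_(1 <= i < m.+1)
    zexpg (if odd i then free_gen true else free_gen false) (eps p q i))%g.

Lemma two_bridge_prefixS m : (two_bridge_prefix m.+1 =
  two_bridge_prefix m * zexpg (free_gen (odd m.+1)) (eps p q m.+1))%g.
Proof. by rewrite /two_bridge_prefix big_nat_recr //=; case: odd. Qed.

(** Each letter exchanges the two lines. An odd letter is a power of b and contributes lam^-1 c, the
    next one is a power of a and contributes c^-1; so each pair multiplies [u] by lam^-1, while the
    signs accumulate in the exponent of t. *)
Lemma swapped_by_prefix c lam u u' k : swapped_by_meridians c lam u u' ->
  u *m (free_mor T (two_bridge_prefix k.*2) : 'M_n) =
    (t ^ eps_sum p q k.*2 * lam ^- k) *: u /\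
  u *m (free_mor T (two_bridge_prefix k.*2.+1) : 'M_n) =
    (t ^ eps_sum p q k.*2.+1 * (lam ^- k.+1 * c)) *: u'.
Proof.
move=> h; have h' := swapped_by_meridiansC h.
have step j : u *m (free_mor T (two_bridge_prefix j.*2) : 'M_n) =
    (t ^ eps_sum p q j.*2 * lam ^- j) *: u ->
  u *m (free_mor T (two_bridge_prefix j.*2.+1) : 'M_n) =
    (t ^ eps_sum p q j.*2.+1 * (lam ^- j.+1 * c)) *: u'.
  move=> e; rewrite two_bridge_prefixS gmulfM gmulf_zexpg /= free_mor_gen.
  rewrite mulmxA e -scalemxAl (swapped_by_letter _ h (eps_sign _ _ _)) scalerA.
  congr (_ *: _); rewrite eps_sumS expfzDr //= odd_double expr1 exprS invfM.
  by ring.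
suff e : u *m (free_mor T (two_bridge_prefix k.*2) : 'M_n) =
    (t ^ eps_sum p q k.*2 * lam ^- k) *: u by split=> //; exact: step.
elim: k => [|k IHk].
  rewrite /two_bridge_prefix /eps_sum !big_geq // gmulf1 mulmx1.
  by rewrite expr0z expr0 invr1 mulr1 scale1r.
rewrite doubleS two_bridge_prefixS gmulfM gmulf_zexpg /= free_mor_gen.
rewrite mulmxA (step _ IHk) -scalemxAl (swapped_by_letter _ h' (eps_sign _ _ _)).
rewrite scalerA; congr (_ *: _); rewrite [in RHS]eps_sumS expfzDr //=.
case: h => c0 _ _; rewrite odd_double /= expr0 invr1 mul1r.
by move: (lam ^- _) (t ^ _) (t ^ _) => L x y; field.
Qed.

(** Truncating the word opens the Fox matrix to induction on pairs of letters. *)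
Definition fox_partial (m : nat) : 'M[K]_n :=
  1%:M + ((T false : 'M_n) - 1%:M) *m eval (fox false (two_bridge_prefix m)).

(** In the product rule the first letter of the new pair is a power of b, whose derivative with
    respect to a is 0; the second is a or a^-1, with derivative 1 or -a^-1. *)
Lemma fox_partialSS k : fox_partial k.+1.*2 = fox_partial k.*2 +
  ((T false : 'M_n) - 1%:M) *m (free_mor T (two_bridge_prefix k.*2.+1) : 'M_n) *m
    (if eps p q k.+1.*2 == 1 then 1%:M else - (GL_mx (T false)^-1%g)).
Proof.
rewrite /fox_partial doubleS 2!two_bridge_prefixS -!addrA; congr (_ + _).
rewrite -mulmxA -mulmxDr; congr (_ *m _).
rewrite !fox_mul !mx_evalD !mx_eval_lmul -!addrA; congr (_ + _).
have -> : fox false (zexpg (free_gen (odd k.*2.+1)) (eps p q k.*2.+1)) = 0.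
  rewrite /= odd_double /=; case: (eps_sign p q k.*2.+1) => -> /=;
  by rewrite /fox /= /fox_letter /= group_lmul0 addr0.
rewrite mx_eval0 mulmx0 add0r -two_bridge_prefixS; congr (_ *m _).
rewrite /= odd_double /=; case: (eps_sign p q k.*2.+2) => -> /=.
  by rewrite /fox /= /fox_letter /= group_lmul0 addr0 mx_evalU gmulf1.
rewrite /fox /= /fox_letter /= group_lmul0 addr0 mx_evalN mx_evalU.
by rewrite gmulfV /= free_mor_gen.
Qed.

(** If the j-th even sign is 1, the summand a of a - 1 yields the term lam^j on [u] and the summand
    -1 the term lam^-j on [u']. If it is -1, the extra factor -a^-1 exchanges these two roles, so
    lam^j lands on [u'] and lam^-j on [u]. This accounts for the exponent j times eps_2j in both
    sums, and for lam^-1 in the second one. *)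
Lemma fox_partial_row c lam u u' k : swapped_by_meridians c lam u u' ->
  u *m fox_partial k.*2 =
  (1 + \sum_(1 <= j < k.+1) t ^ eps_sum p q (2 * j) * lam ^ (j%:Z * eps p q (2 * j)))
    *: u
  - (c * \sum_(1 <= j < k.+1)
      t ^ eps_sum p q (2 * j - 1) * lam^-1 ^ (j%:Z * eps p q (2 * j))) *: u'.
Proof.
move=> h; have h' := swapped_by_meridiansC h; have [c0 lam0 hT] := h.
elim: k => [|k IHk].
  rewrite !big_geq // mulr0 scale0r subr0 addr0 scale1r /fox_partial.
  by rewrite /two_bridge_prefix big_geq // mx_eval0 mulmx0 addr0 mulmx1.
rewrite fox_partialSS mulmxDr IHk !mulmxA mulmxBr mulmx1 2!mulmxBl.
rewrite (hT false).1 (swapped_by_prefix k h).2.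
rewrite -[_ *: _ *m _]scalemxAl (swapped_by_prefix k h').2 scalerA.
rewrite 2?(@big_nat_recr _ _ _ k.+1 1) //=.
rewrite mul2n doubleS (_ : (k.*2.+2 - 1)%N = k.*2.+1) ?subn1 //.
set E := (X in (1 + (X + _)) *: u); set D := (X in c * (X + _)).
rewrite -/E -/D.
have inv_row c1 lam1 v v' : swapped_by_meridians c1 lam1 v v' ->
    v *m invmx (T false) = (t^-1 * c1) *: v'.
  move=> hv; have := swapped_by_letter false hv (or_intror (erefl (-1))).
  by rewrite /= expr0 invr1 mul1r exprN1.
have L0 : lam ^+ k.+1 != 0 by rewrite expf_neq0.
rewrite [eps_sum p q k.*2.+2]eps_sumS expfzDr //.
have := inv_row _ _ _ _ h; have := inv_row _ _ _ _ h'.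
case: (eps_sign p q k.*2.+2) => -> uV u'V.
  rewrite eqxx !mulmx1 !mulr1 !expr1z; apply/rowP => i; rewrite !mxE.
  rewrite -!exprnP !exprVn invrK expr0; move: L0 (t ^ _) => L0 s; field.
  by rewrite c0 L0 oner_neq0.
rewrite (_ : (-1 == 1 :> int) = false) // !mulmxN -!scalemxAl uV u'V.
rewrite !scalerA !mulrN1 -!exprnN.
apply/rowP => i; rewrite !mxE !exprVn invrK expr0.
move: L0 (t ^ _) => L0 s; field.
by rewrite c0 L0 t_neq0 oner_neq0.
Qed.

End EvalFox.

(** * Geometric rows and the Fourier basis *)

(** For a^l = 1 this is a left eigenvector of [cycle_mx] with eigenvalue a. *)
Definition geometric_row (K : fieldType) (l : nat) (a : K) : 'rV[K]_l :=
  \row_j a ^+ j.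

(** The flip turns a^j into a^(l-1-j) = a^-1 a^-j, and the k-th power of the cycle then contributes
    a^-k; the reversal accounts for the extra 1 in [k.+1]. *)
Lemma geometric_row_reflection (F K : fieldType) (f : {rmorphism F -> K})
    (l k : nat) (a : K) :
    (0 < l)%N -> a ^+ l = 1 ->
  geometric_row l a *m map_mx f (GL_flip l F * GL_cycle l F ^+ k)%g =
    a ^- k.+1 *: geometric_row l a^-1.
Proof.
move=> l_gt0 al; have a0 : a != 0.
  by apply: contra_eq_neq al => ->; rewrite expr0n gtn_eqF // eq_sym oner_neq0.
apply/rowP => j; rewrite mxE.
(* The row of the only nonzero entry in column j. *)
pose i0 := rev_ord (Ordinal (ltn_pmod (j + k) l_gt0)).
have entry i : map_mx f (GL_flip l F * GL_cycle l F ^+ k)%g i j = (i == i0)%:R.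
  rewrite mxE flip_mxM GL_cycle_expgE rmorph_nat; congr (nat_of_bool _)%:R.
  by rewrite -[_ == _]/(Ordinal (ltn_pmod (j + k) l_gt0) == rev_ord i)
             -(inj_eq rev_ord_inj) rev_ordK eq_sym.
rewrite (bigD1 i0) //= big1 ?addr0 => [|i /negbTE ne_i]; last first.
  by rewrite entry ne_i mulr0.
rewrite entry eqxx mulr1 !mxE /= exprVn -invfM -exprD.
apply: (mulIf (expf_neq0 (k.+1 + j) a0)); rewrite mulVf ?expf_neq0 //.
have -> : (k.+1 + j = (j + k).+1)%N by lia.
rewrite -exprD {2}(divn_eq (j + k) l) -addnS addnCA.
rewrite [(_ * l)%N]mulnC exprD exprM al expr1n mul1r subnK ?al //.
by rewrite ltn_pmod.
Qed.

(** Apart from t, the meridians a and b act with factors a^-(r false + 1) and a^-(r true + 1), where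
    a is now the root of unity; the slope hypothesis says that the second is lam^-1 times the
    first. *)
Lemma geometric_row_swapped (F K : fieldType) (f : {rmorphism F -> K}) (l : nat)
    (t : K) (T : bool -> GL l K) (r : bool -> nat) (a lam : K) :
    (0 < l)%N -> a ^+ l = 1 -> a ^+ r true = lam * a ^+ r false ->
    (forall s, (T s : 'M_l) = t *: map_mx f (GL_flip l F * GL_cycle l F ^+ r s)%g) ->
  swapped_by_meridians t T (a ^- (r false).+1) lam
    (geometric_row l a) (geometric_row l a^-1).
Proof.
move=> l_gt0 al slope TE.
have a0 : a != 0.
  by apply: contra_eq_neq al => ->; rewrite expr0n gtn_eqF // eq_sym oner_neq0.
have lam0 : lam != 0.
  by apply: contra_eq_neq slope => ->; rewrite mul0r expf_neq0.
have slopes s : a ^+ (r s).+1 = lam ^+ s * a ^+ (r false).+1.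
  by case: s; rewrite ?expr0 ?mul1r // exprS slope mulrCA -exprS.
split=> // [|s]; first by rewrite invr_eq0 expf_neq0.
split; rewrite TE -scalemxAr geometric_row_reflection ?exprVn ?al ?invr1 //.
  by rewrite scalerA slopes invfM.
by rewrite [a^-1^-1]invrK scalerA !invrK -slopes.
Qed.

Section Fourier.
Variables (K : fieldType) (n : nat) (z : K).
Local Notation l := (1 + (n + n))%N.
Hypothesis z_prim : l.-primitive_root z.

(** The nodes 1, z^(k+1), z^-(k+1) run once through all l-th roots of unity because l = 2n + 1, so
    this is a transposed Vandermonde matrix with distinct nodes. *)
Lemma fourier_unitmx :
  col_mx (geometric_row l 1) (col_mx (\matrix_(k < n) geometric_row l (z ^+ k.+1))
    (\matrix_(k < n) geometric_row l (z ^- k.+1))) \in unitmx.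
Proof.
(* The exponent -(k+1) is represented by its residue n + n - k modulo l. *)
pose e (i : 'I_l) : nat := match fintype.split i with
  | inl _ => 0
  | inr j => match fintype.split j with inl k => k.+1 | inr k => (n + n - k)%N end end.
pose a := \row_i z ^+ e i.
set P := col_mx _ _; suff -> : P = (Vandermonde l a)^T.
  rewrite unitmx_tr; apply: Vandermonde_unitmx => i j; rewrite !mxE => /eqP.
  rewrite (eq_prim_root_expr z_prim) /e.
  have lt_k (k : 'I_n) : (k.+1 < l)%N by have := ltn_ord k; lia.
  have lt_k' (k : 'I_n) : (n + n - k < l)%N by lia.
  case: splitP => [i' ei|i' ei]; [|case: splitP => k ek];
  (case: splitP => [j' ej|j' ej]; [|case: splitP => m em]);
  rewrite ?mod0n ?modn_small // => /eqP h; apply: val_inj => /=;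
  rewrite ei ej ?ek ?em ?ord1 //=;
  try (have := ltn_ord k); try (have := ltn_ord m); lia.
apply/matrixP => i j; rewrite /P !mxE /e.
case: splitP => [i' _|i' _]; first by rewrite !mxE !expr1n.
rewrite mxE; case: splitP => k _; rewrite !mxE //.
congr (_ ^+ _); apply: (mulIf (expf_neq0 k.+1 (_ : z != 0))).
  by rewrite (prim_root_eq0 z_prim).
rewrite mulVf ?expf_neq0 ?(prim_root_eq0 z_prim) // -exprD.
by rewrite addnS -addSn -subSn ?subnK ?(prim_expr_order z_prim) //; have := ltn_ord k; lia.
Qed.

End Fourier.

(** * The twisted polynomial when the meridians are given reflections *)

Lemma alternating_sum_eps (K : fieldType) (p q : nat) (t : K) (h : nat) :
  \sum_(0 <= k < h.*2.+1) (-1) ^+ k * t ^ eps_sum p q k =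
  1 + \sum_(1 <= j < h.+1) t ^ eps_sum p q (2 * j)
    - \sum_(1 <= j < h.+1) t ^ eps_sum p q (2 * j - 1).
Proof.
elim: h => [|h IHh].
  by rewrite big_nat1 !big_geq // expr0 mul1r /eps_sum big_geq // subr0 addr0.
rewrite doubleS 2?(big_nat_recr _ 0) //= IHh !(big_nat_recr h.+1 1) //=.
rewrite mul2n doubleS (_ : (h.*2.+2 - 1)%N = h.*2.+1) ?subn1 //.
by rewrite !exprS -signr_odd odd_double expr0; ring.
Qed.

Section TwistedAlexanderFormula.
Variables (R : realType) (p q n : nat).
Local Notation l := (1 + (n + n))%N.
Local Notation K := {fraction {poly R[i]}}.
Local Notation t := (ct_var : K).
Hypothesis q_odd : odd q.
Variables (phi : knot_group p q -> GL l R[i]) (r : bool -> nat) (z lam : R[i]).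
Hypothesis phi_gen : forall s,
  phi (pres_gen (knot_rels p q) s) = (GL_flip l _ * GL_cycle l _ ^+ r s)%g.
Hypothesis z_prim : l.-primitive_root z.
Hypothesis z_slope : z ^+ r true = lam * z ^+ r false.

Let f : {rmorphism R[i] -> K} := @tofrac {poly R[i]} \o @polyC R[i].

Let t_neq0 : t != 0.
Proof. by rewrite /ct_var tofrac_eq0 polyX_eq0. Qed.

Lemma geometric_row_meridians (b : R[i]) (c : R[i]) : b ^+ l = 1 ->
  b ^+ r true = c * b ^+ r false ->
  swapped_by_meridians t (tphi phi) (f b ^- (r false).+1) (f c)
    (geometric_row l (f b)) (geometric_row l (f b)^-1).
Proof.
move=> bl slope; apply: (@geometric_row_swapped _ _ f) => //.
- by rewrite -rmorphXn bl rmorph1.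
- by rewrite -!rmorphXn slope rmorphM.
- by move=> s; rewrite /tphi /= phi_gen.
Qed.

Lemma fox_matrix_partial :
  fox_matrix phi = fox_partial p q (tphi phi) (q.-1)./2.*2.
Proof.
have -> : (q.-1)./2.*2 = q.-1 by rewrite even_halfK //; case: q q_odd.
by rewrite /fox_matrix /fox_partial /two_bridge_word /two_bridge_prefix prednK ?odd_gt0.
Qed.

Lemma fox_matrix_row (b c : R[i]) : b ^+ l = 1 ->
  b ^+ r true = c * b ^+ r false ->
  geometric_row l (f b) *m fox_matrix phi =
  e_poly p q c *: geometric_row l (f b)
  - (f b ^- (r false).+1 * d_poly p q c^-1) *: geometric_row l (f b)^-1.
Proof.
move=> bl slope; rewrite fox_matrix_partial.
rewrite (fox_partial_row _ _ t_neq0 _ (geometric_row_meridians bl slope)).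
rewrite /e_poly /d_poly; congr ((1 + _) *: _ - (_ * _) *: _).
  by apply: eq_bigr => k _; rewrite -[ct_const _]/(f _) fmorphXz.
by apply: eq_bigr => k _; rewrite -[ct_const _]/(f _) fmorphXz fmorphV.
Qed.

Lemma alexander_ed : alexander p q = e_poly p q 1 - d_poly p q 1 :> K.
Proof.
rewrite /alexander; have {1}-> : q = (q.-1)./2.*2.+1.
  by rewrite even_halfK ?prednK ?odd_gt0 //; case: q q_odd.
rewrite alternating_sum_eps; congr (1 + _ - _).
  by apply: eq_bigr => k _; rewrite exp1rz -[ct_const _]/(f 1) rmorph1 mulr1.
by apply: eq_bigr => k _; rewrite exp1rz -[ct_const _]/(f 1) rmorph1 mulr1.
Qed.

Lemma z_exp_unity (k : nat) : (z ^+ k) ^+ l = 1.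
Proof. by rewrite exprAC (prim_expr_order z_prim) expr1n. Qed.

Lemma slope_exp (k : nat) : (z ^+ k) ^+ r true = lam ^+ k * (z ^+ k) ^+ r false.
Proof. by rewrite exprAC z_slope exprMn exprAC. Qed.

Lemma slope_expN (k : nat) : (z ^- k) ^+ r true = lam ^- k * (z ^- k) ^+ r false.
Proof. by rewrite !exprVn slope_exp invfM. Qed.

Lemma z_exp_unityN (k : nat) : (z ^- k) ^+ l = 1.
Proof. by rewrite exprVn z_exp_unity invr1. Qed.

Let fz_prim : l.-primitive_root (f z).
Proof. by rewrite fmorph_primitive_root. Qed.

(** Both the Fox matrix and t phi(b) - 1 respect the Fourier decomposition, so this serves the
    numerator and the denominator alike. *)
Lemma det_geometric_pairs (M : 'M[K]_l) (c0 : K) (F G : nat -> K) (G' H : nat -> K) :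
    geometric_row l (f 1) *m M = c0 *: geometric_row l (f 1) ->
    (forall k, geometric_row l (f (z ^+ k.+1)) *m M =
      F k *: geometric_row l (f (z ^+ k.+1)) + G k *: geometric_row l (f (z ^+ k.+1))^-1) ->
    (forall k, geometric_row l (f (z ^- k.+1)) *m M =
      H k *: geometric_row l (f (z ^- k.+1)) + G' k *: geometric_row l (f (z ^- k.+1))^-1) ->
  \det M = c0 * \prod_(k < n) (F k * H k - G k * G' k).
Proof.
move=> M1 MV MW; rewrite rmorph1 in M1.
rewrite (@det_paired_rows _ n M _ _ _ c0 (\row_k F k) (\row_k G k) (\row_k G' k)
  (\row_k H k) (fourier_unitmx fz_prim)) //.
- by congr (_ * _); apply: eq_bigr => k _; rewrite !mxE.
- by move=> k; rewrite !rowK !mxE -!rmorphXn MV.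
- by move=> k; rewrite !rowK !mxE -!rmorphXn -fmorphV MW -fmorphV invrK.
Qed.

Lemma twisted_alexanderE :
  twisted_alexander phi = alexander p q / (t - 1) *
    \prod_(k < n) ((d_poly p q (lam ^+ k.+1) * d_poly p q (lam ^- k.+1)
                   - e_poly p q (lam ^+ k.+1) * e_poly p q (lam ^- k.+1))
                    / (t ^+ 2 - 1)).
Proof.
have z0 : z != 0 by rewrite (prim_root_eq0 z_prim).
have slope1 : 1 ^+ r true = 1 * 1 ^+ r false :> R[i] by rewrite !expr1n mulr1.
rewrite /twisted_alexander.
rewrite (@det_geometric_pairs (fox_matrix phi) (alexander p q)
  (fun k => e_poly p q (lam ^+ k.+1))
  (fun k => - (f (z ^+ k.+1) ^- (r false).+1 * d_poly p q (lam ^- k.+1)))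
  (fun k => - (f (z ^- k.+1) ^- (r false).+1 * d_poly p q (lam ^+ k.+1)))
  (fun k => e_poly p q (lam ^- k.+1))); first last.
- by move=> k; rewrite (fox_matrix_row (z_exp_unityN _) (slope_expN _)) invrK scaleNr.
- by move=> k; rewrite (fox_matrix_row (z_exp_unity _) (slope_exp _)) scaleNr.
- rewrite (fox_matrix_row (expr1n _ _) slope1) rmorph1 !expr1n !invr1 mul1r.
  by rewrite -scalerBl -alexander_ed.
(* On each plane t phi(b) - 1 has diagonal entries -1 and off-diagonal entries with product t^2. *)
rewrite (@det_geometric_pairs _ (t - 1) (fun=> -1)
  (fun k => t * (f (lam ^- k.+1) * f (z ^+ k.+1) ^- (r false).+1))
  (fun k => t * (f (lam ^+ k.+1) * f (z ^- k.+1) ^- (r false).+1))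
  (fun=> -1)); first last.
- move=> k; have [_ _ /(_ true) [h _]] := geometric_row_meridians (z_exp_unityN k.+1) (slope_expN k.+1).
  by rewrite mulmxBr mulmx1 h expr1 scaleN1r addrC -fmorphV invrK.
- move=> k; have [_ _ /(_ true) [h _]] := geometric_row_meridians (z_exp_unity k.+1) (slope_exp k.+1).
  by rewrite mulmxBr mulmx1 h expr1 scaleN1r addrC -fmorphV.
- have [_ _ /(_ true) [h _]] := geometric_row_meridians (expr1n _ _) slope1.
  rewrite mulmxBr mulmx1 h expr1 rmorph1 !invr1 !expr1n invr1 !mulr1 scalerBl.
  by rewrite scale1r.
have lam0 : lam != 0.
  by apply: contra_eq_neq z_slope => ->; rewrite mul0r expf_neq0.
rewrite invfM mulrACA; congr (_ * _).
rewrite -prodfV -big_split; apply: eq_bigr => k _ /=.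
(* The scalars [A] and [B] attached to the two lines of a plane are reciprocal and cancel from both
   determinants. *)
set A := f (z ^+ _) ^- _; set B := f (z ^- _) ^- _.
have AB : A * B = 1.
  by rewrite /A /B -invfM -exprMn -rmorphM mulfV ?expf_neq0 // rmorph1 expr1n invr1.
have LL : f (lam ^- k.+1) * f (lam ^+ k.+1) = 1.
  by rewrite -rmorphM mulVf ?expf_neq0 // rmorph1.
rewrite !mulrNN mulr1 mulrACA AB mul1r mulrACA [f _ * A * _]mulrACA LL AB !mulr1.
(* Changing the sign of numerator and denominator gives the stated fraction. *)
rewrite -expr2 [d_poly p q (lam ^- _) * _]mulrC -[X in X / _]opprB -[1 - _]opprB.
by rewrite invrN mulrNN.
Qed.

End TwistedAlexanderFormula.

(** * Reduction of an arbitrary surjection to given reflections *)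

Lemma dihedral_reprE (K : fieldType) (l k : nat) :
  dihedral_repr K (pres_gen (dihedral_rels l) false *
                   pres_gen (dihedral_rels l) true ^+ k)%g =
  (GL_flip l K * GL_cycle l K ^+ k)%g.
Proof. by rewrite gmulfM gmulfXn /= dihedral_repr_x dihedral_repr_y. Qed.

(** The relation aw = wb passes to the images of the meridians, and surjectivity makes these images
    generate, so [dihedral_generating_pair] applies. *)
Lemma surjection_meridians (p q l : nat)
    (rho : {multiplicative knot_group p q -> dihedral_group l}) :
    (1 < l)%N -> (forall y, exists x, rho x = y) ->
  exists r : bool -> nat, r true != r false %[mod l] /\
    forall s, rho (pres_gen (knot_rels p q) s) =
      (pres_gen (dihedral_rels l) false * pres_gen (dihedral_rels l) true ^+ r s)%g.
Proof.
move=> l_gt1 rho_surj.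
have rho1 : rho 1%g = 1%g.
  by apply: (mulgI (rho 1%g)); rewrite -gmulfM !mulg1.
have rhoV g : rho g^-1%g = (rho g)^-1%g.
  by apply: (mulgI (rho g)); rewrite -gmulfM !mulgV.
pose w := free_mor (pres_gen (knot_rels p q)) (two_bridge_word p q).
have rel : (pres_gen (knot_rels p q) false * w = w * pres_gen (knot_rels p q) true)%g.
  have := pres_relator (mem_head _ _ : _ \in knot_rels p q).
  by rewrite gmulfF 2!gmulfM /= !free_mor_gen => /divg1_eq.
have gen (P : dihedral_group l -> Prop) : P 1%g ->
    (forall g, P g -> [/\ P (rho (pres_gen (knot_rels p q) false) * g)%g,
                          P (rho (pres_gen (knot_rels p q) true) * g)%g,
                          P ((rho (pres_gen (knot_rels p q) false))^-1 * g)%g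
                        & P ((rho (pres_gen (knot_rels p q) true))^-1 * g)%g]) ->
    forall g, P g.
  move=> P1 Pstep g; have [x <-] := rho_surj g.
  elim/pres_group_ind: x => [|s x /Pstep[]|s x /Pstep[]]; first by rewrite rho1.
    by rewrite gmulfM; case: s.
  by rewrite gmulfM rhoV; case: s.
have := congr1 rho rel; rewrite 2!gmulfM => rho_rel.
have [i [j [ai bj ij]]] := dihedral_generating_pair l_gt1 rho_rel gen.
exists (fun s => if s then j else i); split; first by rewrite eq_sym.
by case.
Qed.

Theorem theorem4 (R : realType) (p q l : nat)
    (p_odd : odd p) (q_odd : odd q) (p_gt0 : (0 < p)%N) (p_lt_q : (p < q)%N)
    (pq_coprime : coprime p q)
    (l_prime : prime l) (l_odd : odd l) (l_dvd_q : (l %| q)%N)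
    (rho : {multiplicative knot_group p q -> dihedral_group l})
    (rho_surj : forall y : dihedral_group l,
       exists x : knot_group p q, rho x = y) :
  let t : {fraction {poly R[i]}} := ct_var in
  let d := d_poly p q : R[i] -> {fraction {poly R[i]}} in
  let e := e_poly p q : R[i] -> {fraction {poly R[i]}} in
  let lam : R[i] := lambda l in
  eq_upto_unit l
    (twisted_alexander (fun g => dihedral_repr R[i] (rho g)))
    (alexander p q / (t - 1) *
     \prod_(1 <= i < (l.-1)./2.+1)
       ((d (lam ^+ i) * d (lam ^- i) - e (lam ^+ i) * e (lam ^- i))
          / (t ^+ 2 - 1))).
Proof.
move=> t d e lam; exists false, 0; rewrite mul0r expr0z !mul1r.
have l_gt2 : (2 < l)%N by case: l l_prime l_odd {l_dvd_q rho rho_surj lam} => [|[|[]]].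
have lE : l = (1 + ((l.-1)./2 + (l.-1)./2))%N by lia.
have lam_prim : l.-primitive_root lam.
  exact: prim_root_prime l_prime (lambda_expl R l_gt2) (lambda_neq1 R l_gt2).
have [r [r_neq rhoE]] := surjection_meridians (prime_gt1 l_prime) rho_surj.
have [z z_prim z_slope] : exists2 z : R[i], l.-primitive_root z &
    z ^+ r true = lam * z ^+ r false.
  by apply: exists_root_slope => //; rewrite eq_sym.
(* The block decomposition needs the dimension in the form [1 + (n + n)]; [lam] is generalized
   before [l] is substituted because its value mentions [l]. *)
move: (l.-1)./2 lE => n lE.
rewrite big_add1 big_mkord /d /e /t.
move: lam lam_prim z_slope => lam' _ z_slope {d e t l_prime l_odd l_dvd_q rho_surj l_gt2 r_neq}.
subst l.
apply: (twisted_alexanderE q_odd _ z_prim z_slope) => // s.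
by rewrite rhoE dihedral_reprE.
Qed.
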